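(* Let $p\equiv 1\pmod 4$ be a prime number. If $a,b,\Delta$ are positive integers such that $$ab(ab-1)-pa=\Delta^2\qquad\text{and}\qquad b\equiv 3\pmod 4,$$ then $$\left(\frac{ab}{p}\right)=\left(\frac{ab-1}{p}\right)=-1.$$
   Context: For an odd prime $p$ and an integer $m$, $\left(\frac{m}{p}\right)$ denotes the Legendre symbol: it is $1$ if $p\nmid m$ and $m$ is a quadratic residue modulo $p$, $-1$ if $p\nmid m$ and $m$ is a quadratic nonresidue modulo $p$, and $0$ if $p\mid m$. *)

(* Defs.v *)
From mathcomp Require Import all_boot all_order all_algebra.

Set Implicit Arguments.
Unset Strict Implicit.
Unset Printing Implicit Defensive.

Import Order.TTheory GRing.Theory Num.Theory.

Local Open Scope ring_scope.

(* Squares modulo p, decided by searching the representatives 0, ..., p - 1;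
   see is_square_modP for the usual formulation over all integers. *)
Definition is_square_mod (p : nat) (m : int) : bool :=
  [exists x : 'I_p, ((x : nat)%:Z ^+ 2 == m %[mod p%:Z])%Z].

Lemma is_square_modP (p : nat) (m : int) : (0 < p)%N ->
  reflect (exists x : int, (x ^+ 2 = m %[mod p%:Z])%Z) (is_square_mod p m).
Proof.
move=> p_gt0; apply: (iffP existsP) => [[x /eqP xm]|[x xm]].
  by exists (x : nat)%:Z.
have p_neq0 : p%:Z != 0 by rewrite eqz_nat -lt0n.
have x_ge0 : 0 <= (x %% p%:Z)%Z by apply: modz_ge0.
have x_lt : (`|(x %% p%:Z)%Z|%N < p)%N.
  by rewrite -ltz_nat gez0_abs // ltz_pmod.
exists (Ordinal x_lt); apply/eqP.
by rewrite /= gez0_abs // -xm modzXm.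
Qed.

(* The Legendre symbol (m / p); meaningful when p is an odd prime. *)
Definition legendre (p : nat) (m : int) : int :=
  if (p%:Z %| m)%Z then 0 else if is_square_mod p m then 1 else -1.

(* Main.v *)
(* Put N = ab - 1, so that N(N + 1) = pa + Delta^2 and N = -1 (mod b).
   Every divisor m of N satisfies pb = -(b Delta)^2 (mod m), so for odd m prime
   to p reciprocity for the Jacobi symbol gives (m/p) = (m/b).  If N is exactly
   divisible by an odd power of 2, the equation modulo 8 forces pb = 7 (mod 8),
   hence (2/p) = (2/b); so (k/p) = (k/b) also for even divisors k of N with N/k
   odd.  When p does not divide N, k = N gives (N/p) = (N/b) = (-1/b) = -1; then
   p does not divide N + 1, as (-1/p) = 1, and N(N + 1) = Delta^2 (mod p) gives
   ((N + 1)/p) = -1.  When N = pk, then p divides Delta and k = a (mod p), so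
   that (k/b) = (k/p) = (a/p) = (b/p) = (p/b), contradicting (pk/b) = -1. *)
Require Import Defs.
From mathcomp Require Import all_boot all_order all_algebra.
From mathcomp Require Import zify.

Set Implicit Arguments.
Unset Strict Implicit.
Unset Printing Implicit Defensive.

Import Order.TTheory GRing.Theory Num.Theory.

Local Open Scope ring_scope.

(** * Sign counts for an odd modulus *)

Section Jacobi.
Local Open Scope nat_scope.

(* The Gauss-Schering count: for odd n and a prime to n, jacobi_neg a n holds
   exactly when the Jacobi symbol (a/n) is -1, n composite allowed; (+) is thus
   the product of symbols. *)
Definition jacobi_neg (a n : nat) : bool :=
  \big[addb/false]_(i < n./2) (n./2 < (a * i.+1) %% n).

(** For odd [n], the absolute value of the residue of [a * i] between [-n./2] and [n./2]. *)
Definition abs_residue (a n i : nat) : nat :=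
  let r := (a * i) %% n in if n./2 < r then n - r else r.

Lemma abs_residue_bounds (a n i : nat) : odd n -> coprime a n ->
  0 < i <= n./2 -> 0 < abs_residue a n i <= n./2.
Proof.
move=> on can /andP[i0 ih]; rewrite /abs_residue.
have n0 : 0 < n by case: n on {can ih}.
have r_lt : (a * i) %% n < n by rewrite ltn_mod.
have r0 : 0 < (a * i) %% n.
  rewrite lt0n; apply/negP => /dvdnP[q e].
  have : n %| a * i by rewrite e dvdn_mull.
  rewrite Gauss_dvdr 1?coprime_sym // => /(dvdn_leq i0); lia.
by case: ifP => H; lia.
Qed.

(** Equality forces [n] to divide [a * (j - i)] or [a * (i + j)]; the second is impossible because
    [0 < i + j < n]. *)
Lemma abs_residue_inj (a n i j : nat) : odd n -> coprime a n ->
  0 < i <= n./2 -> 0 < j <= n./2 -> abs_residue a n i = abs_residue a n j ->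
  i = j.
Proof.
move=> on can Hi Hj.
wlog le_ij : i j Hi Hj / i <= j.
  by move=> H e; case: (leqP i j) => [|/ltnW] l; [|symmetry]; exact: H.
have n0 : 0 < n by case: n on {can Hi Hj}.
have nD : ~~ (n %| a * (i + j)).
  rewrite Gauss_dvdr 1?coprime_sym //; apply/negP => /dvdn_leq; lia.
have nB : n %| a * (j - i) -> i = j.
  rewrite Gauss_dvdr 1?coprime_sym // => /dvdnP[[|q]]; nia.
have ri : (a * i) %% n < n by rewrite ltn_mod.
have rj : (a * j) %% n < n by rewrite ltn_mod.
rewrite /abs_residue; case: ifP => _; case: ifP => _ e.
- apply: nB; rewrite mulnBr -eqn_mod_dvd ?leq_mul2l ?le_ij ?orbT //.
  by apply/eqP; lia.
- case/negP: nD; rewrite mulnDr /dvdn -modnDm.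
  by rewrite (_ : _ + _ = n) ?modnn //; lia.
- case/negP: nD; rewrite mulnDr /dvdn -modnDm.
  by rewrite (_ : _ + _ = n) ?modnn //; lia.
- apply: nB; rewrite mulnBr -eqn_mod_dvd ?leq_mul2l ?le_ij ?orbT //.
  by apply/eqP; lia.
Qed.

(** Gauss's permutation: the absolute residues of the first [n./2] multiples of [a] rearrange
    [1, ..., n./2]. *)
Lemma big_abs_residue (T : Type) (idx : T) (op : Monoid.com_law idx)
    (a n : nat) (F : nat -> T) : odd n -> coprime a n ->
  \big[op/idx]_(i < n./2) F (abs_residue a n i.+1)
    = \big[op/idx]_(i < n./2) F i.+1.
Proof.
move=> on can.
have bnd (i : 'I_n./2) : 0 < abs_residue a n i.+1 <= n./2.
  by apply: abs_residue_bounds => //=; exact: ltn_ord.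
have lt (i : 'I_n./2) : (abs_residue a n i.+1).-1 < n./2.
  by have := bnd i; lia.
pose s (i : 'I_n./2) : 'I_n./2 := Ordinal (lt i).
have s_inj : injective s.
  move=> i j /(congr1 val) /= e; apply/val_inj/succn_inj.
  apply: (@abs_residue_inj a n) => //=; try exact: ltn_ord.
  by have := bnd i; have := bnd j; lia.
rewrite [RHS](reindex_inj s_inj); apply: eq_bigr => i _ /=.
by rewrite prednK //; have /andP[] := bnd i.
Qed.

Lemma jacobi_neg_mod (a b n : nat) : a = b %[mod n] ->
  jacobi_neg a n = jacobi_neg b n.
Proof.
move=> e; apply: eq_bigr => i _.
by rewrite -modnMml e modnMml.
Qed.

Lemma modn_opp (n i j : nat) : 0 < n -> n %| i + j -> ~~ (n %| i) ->
  j %% n = n - i %% n.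
Proof.
move=> n0 d nd.
have ri : i %% n < n by rewrite ltn_mod.
have rj : j %% n < n by rewrite ltn_mod.
move: nd d; rewrite /dvdn -modnDm => nd.
by move=> /dvdnP[[|[|q]]]; nia.
Qed.

(** Reindex the count for [a] by the absolute residues of the multiples of [b]: each index counted
    for [b] negates its multiple of [a], which flips the comparison with [n./2]. *)
Lemma jacobi_negM (a b n : nat) : odd n -> coprime a n -> coprime b n ->
  jacobi_neg (a * b) n = jacobi_neg a n (+) jacobi_neg b n.
Proof.
move=> on ca cb.
have n0 : 0 < n by case: n on {ca cb}.
rewrite {2}/jacobi_neg.
rewrite -(@big_abs_residue _ _ addb b n (fun i => n./2 < (a * i) %% n)) //.
rewrite -big_split /=; apply: eq_bigr => i _.
have i_h := ltn_ord i.
have nab : ~~ (n %| a * (b * i.+1)).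
  rewrite !Gauss_dvdr 1?coprime_sym //; apply/negP => /dvdn_leq; lia.
have rb : (b * i.+1) %% n < n by rewrite ltn_mod.
have ra : (a * (b * i.+1)) %% n < n by rewrite ltn_mod.
rewrite /abs_residue -mulnA; case: ifP => _; last by rewrite modnMmr addbF.
rewrite (@modn_opp n (a * (b * i.+1)) (a * (n - _))) //; last first.
  rewrite -(dvdn_addl _ (dvdn_mull (a * ((b * i.+1) %/ n)) (dvdnn n))).
  apply/dvdnP; exists (a * (2 * ((b * i.+1) %/ n)).+1).
  by rewrite {1}(divn_eq (b * i.+1) n); nia.
move: nab; rewrite /dvdn; move: (_ %% n) ra => r; lia.
Qed.

Lemma jacobi_neg_sqr (a n : nat) : odd n -> coprime a n ->
  jacobi_neg (a * a) n = false.
Proof. by move=> on ca; rewrite jacobi_negM // addbb. Qed.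

(** Every index is counted: [n.-1 * i] has residue [n - i], above [n./2]. *)
Lemma jacobi_neg_pred (n : nat) : odd n -> jacobi_neg n.-1 n = odd n./2.
Proof.
move=> on; have n0 : 0 < n by case: n on.
rewrite /jacobi_neg (eq_bigr (fun _ => true)).
  rewrite big_const_ord; elim: n./2 => //= k ->; by rewrite addTb.
move=> i _; have i_h := ltn_ord i.
rewrite (@modn_opp n i.+1) ?modn_small; try lia.
  by rewrite -mulSn prednK ?dvdn_mulr.
by apply/negP => /dvdn_leq; lia.
Qed.

(* Both the value at 2 and Eisenstein's lemma are read off this parity count. *)
Lemma jacobi_neg_sum_div (a n : nat) : odd n -> coprime a n ->
  jacobi_neg a n = odd (\sum_(i < n./2) ((a * i.+1) %/ n)) (+)
                   ~~ odd a && odd (\sum_(i < n./2) i.+1).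
Proof.
move=> on ca; have n0 : 0 < n by case: n on ca.
(* Sum [a * i = q * n + r] modulo 2. As [n] is odd, [r] and the absolute residue differ in parity
   exactly at the counted indices, and the absolute residues have the same sum as the indices. *)
have E : odd (a * \sum_(i < n./2) i.+1)
   = odd (\sum_(i < n./2) ((a * i.+1) %/ n)) (+) (jacobi_neg a n (+)
     odd (\sum_(i < n./2) i.+1)).
  rewrite -(@big_abs_residue _ _ addn a n id) //.
  rewrite [in LHS](@big_abs_residue _ _ addn a n id) //.
  rewrite big_distrr /= !(big_morph odd oddD (erefl : odd 0 = false)).
  rewrite /jacobi_neg -!big_split /=; apply: eq_bigr => i _.
  rewrite {1}(divn_eq (a * i.+1) n) oddD oddM on andbT; congr addb.
  have r_lt : (a * i.+1) %% n < n by rewrite ltn_mod.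
  rewrite /abs_residue; case: ifP => // _.
  by rewrite oddB 1?ltnW // on addTb negbK.
move: E; rewrite oddM.
by case: (odd a); case: (odd _); case: (odd _); case: (jacobi_neg _ _).
Qed.

(** * Reciprocity by lattice points, and supplementary values *)

Lemma count_multiples (n x k : nat) : 0 < n ->
  \sum_(j < k) (n * j.+1 <= x) = minn k (x %/ n).
Proof.
move=> n0; elim: k => [|k IHk]; first by rewrite big_ord0 min0n.
rewrite big_ord_recr /= IHk mulnC -leq_divRL //; lia.
Qed.

Lemma sum_div_count (a n : nat) : odd a -> odd n ->
  \sum_(i < n./2) ((a * i.+1) %/ n)
    = \sum_(i < n./2) \sum_(j < a./2) (n * j.+1 <= a * i.+1).
Proof.
move=> oa on; have n0 : 0 < n by case: n on.
apply: eq_bigr => i _; have i_h := ltn_ord i.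
have q_le : (a * i.+1) %/ n <= a./2 by rewrite -ltnS ltn_divLR //; nia.
by rewrite count_multiples //; lia.
Qed.

(** The two sums count the points of an [n./2] by [a./2] rectangle on the two sides of the line
    [n * y = a * x]; coprimality keeps the line itself free of points. *)
Lemma jacobi_reciprocity (a n : nat) : odd a -> odd n -> coprime a n ->
  jacobi_neg a n (+) jacobi_neg n a = odd a./2 && odd n./2.
Proof.
move=> oa on ca; have ca' : coprime n a by rewrite coprime_sym.
rewrite !jacobi_neg_sum_div // oa on !addbF -oddD !sum_div_count //.
rewrite [X in _ + X]exchange_big -big_split /= -oddM mulnC.
rewrite (eq_bigr (fun _ => a./2)) ?sum_nat_const ?card_ord // => i _.
rewrite -big_split /= (eq_bigr (fun _ => 1)) ?sum1_card ?card_ord // => j _.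
have i_h := ltn_ord i.
have ne : n * j.+1 != a * i.+1.
  apply/eqP => e; have : n %| a * i.+1 by rewrite -e dvdn_mulr.
  by rewrite Gauss_dvdr // => /dvdn_leq; lia.
lia.
Qed.

Lemma jacobi_neg2 (n : nat) : odd n ->
  jacobi_neg 2 n = (n %% 8 == 3) || (n %% 8 == 5).
Proof.
move=> on; have n0 : 0 < n by case: n on.
rewrite jacobi_neg_sum_div ?coprime2n //= big1 => [|i _]; last first.
  by have i_h := ltn_ord i; rewrite divn_small //; lia.
have S2 h : 2 * \sum_(i < h) i.+1 = h * h.+1.
  elim: h => [|h IHh]; first by rewrite big_ord0.
  by rewrite big_ord_recr /= mulnDr IHh; lia.
have := S2 n./2; move: (\sum_(i < _) _) => S.
(* The parity of [S] depends on [n./2] modulo 4, that is, on [n] modulo 8. *)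
have := divn_eq n./2 4; have := ltn_mod n./2 4.
move: (n./2 %/ 4) (n./2 %% 4) => t r r4 e; rewrite e.
have -> : n %% 8 = (2 * r).+1 by lia.
by case: r r4 {e} => [|[|[|[|r]]]] // _ e; rewrite /= ; lia.
Qed.

Lemma jacobi_neg_pow2M (e m n : nat) : odd n -> coprime m n ->
  jacobi_neg (2 ^ e * m) n = odd e && jacobi_neg 2 n (+) jacobi_neg m n.
Proof.
move=> on cm; have c2 : coprime 2 n by rewrite coprime2n.
elim: e => [|e IHe]; first by rewrite mul1n.
rewrite expnS -mulnA jacobi_negM ?coprimeMl ?coprimeXl // IHe /=.
by case: (odd e); case: (jacobi_neg 2 n); case: (jacobi_neg m n).
Qed.

(** Here [c] is [- s ^ 2] modulo [m], so its symbol is that of -1. *)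
Lemma jacobi_neg_oppsqr (c s m : nat) : odd m -> coprime c m ->
  m %| c + s * s -> jacobi_neg c m = odd m./2.
Proof.
move=> om cm d; have m0 : 0 < m by case: m om {cm d}.
have cs : coprime s m.
  rewrite /coprime -dvdn1 -(eqP cm) dvdn_gcd dvdn_gcdr andbT.
  rewrite -(dvdn_addl _ (dvdn_mulr s (dvdn_gcdl s m))).
  exact: dvdn_trans (dvdn_gcdr _ _) d.
have cp : coprime m.-1 m by rewrite coprime_sym -{1}(prednK m0) coprimeSn.
have : jacobi_neg (m.-1 * c) m = jacobi_neg (s * s) m.
  apply: jacobi_neg_mod; apply/eqP; rewrite -(eqn_modDr c) addnC -mulSn prednK //.
  by rewrite modnMr eq_sym addnC.
rewrite jacobi_negM // jacobi_neg_sqr // jacobi_neg_pred //.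
by case: (odd _); case: (jacobi_neg _ _).
Qed.

(** * Divisors of [N]: symbols modulo [p] against symbols modulo [b] *)

Section Equation.

Variables (p a b D N : nat).
Hypotheses (p_mod4 : p %% 4 = 1) (b_mod4 : b %% 4 = 3).
Hypotheses (abN : a * b = N.+1) (eqD : N.+1 * N = p * a + D * D).

Let op : odd p. Proof. by lia. Qed.
Let ob : odd b. Proof. by lia. Qed.
Let op2 : odd p./2 = false. Proof. by lia. Qed.
Let ob2 : odd b./2. Proof. by lia. Qed.

Lemma coprime_b_N : coprime b N.
Proof.
rewrite /coprime -dvdn1 -(dvdn_addr 1 (dvdn_gcdr b N)) addn1 -abN.
by rewrite dvdn_mull ?dvdn_gcdl.
Qed.

(** Multiply the equation by [b * b] and replace [a * b] by [N.+1]. *)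
Lemma dvdN_oppsqr : N %| p * b + (b * D) * (b * D).
Proof.
have : N %| p * b * N + (p * b + (b * D) * (b * D)).
  apply/dvdnP; exists (b * b * N.+1).
  rewrite -[RHS]mulnA eqD; have : p * b * (a * b) = p * b * N.+1 by rewrite abN.
  lia.
by rewrite dvdn_addr ?dvdn_mull.
Qed.

(** Reciprocity with [p] has no sign; reciprocity with [b] has the sign [(-1/m)], which cancels
    against [(pb/m) = (-1/m)]. *)
Lemma odd_cofactor (m : nat) : odd m -> m %| N -> coprime p m ->
  jacobi_neg m p = jacobi_neg m b.
Proof.
move=> om dm cpm.
have cbm : coprime b m := coprime_dvdr dm coprime_b_N.
have := jacobi_neg_oppsqr om _ (dvdn_trans dm dvdN_oppsqr).
rewrite coprimeMl cpm cbm jacobi_negM // => /(_ isT).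
have := jacobi_reciprocity op om cpm; have := jacobi_reciprocity ob om cbm.
rewrite op2 ob2 andTb andFb.
by case: (jacobi_neg p m); case: (jacobi_neg b m); case: (jacobi_neg m p);
  case: (jacobi_neg m b); case: (odd m./2).
Qed.

(** These residues cover every [N] exactly divisible by an odd power of 2: the first power gives 2
    or 6, higher ones give 0. The residues modulo 8 are searched exhaustively. *)
Lemma pb_mod8 : N %% 8 \in [:: 0; 2; 6] -> (p * b) %% 8 = 7.
Proof.
have e1 : (a %% 8 * (b %% 8)) %% 8 = (N %% 8).+1 %% 8.
  by rewrite modnMm abN -addn1 -[in RHS]addn1 modnDml.
have e2 : ((N %% 8).+1 * (N %% 8)) %% 8
          = (p %% 8 * (a %% 8) + D %% 8 * (D %% 8)) %% 8.
  rewrite -modnDm !modnMm modnDm -eqD -addn1 -[in RHS]addn1.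
  by rewrite modnMmr -modnMml modnDml modnMml.
have p8 : p %% 8 \in [:: 1; 5] by rewrite !inE; lia.
have b8 : b %% 8 \in [:: 3; 7] by rewrite !inE; lia.
rewrite -(modnMm p b) => N8.
have a8 : a %% 8 \in iota 0 8 by rewrite mem_iota ltn_mod.
have D8 : D %% 8 \in iota 0 8 by rewrite mem_iota ltn_mod.
have H : all (fun q => all (fun c => all (fun M => all (fun x => all (fun y =>
   ((x * c) %% 8 == M.+1 %% 8) ==> ((M.+1 * M) %% 8 == (q * x + y * y) %% 8) ==>
   ((q * c) %% 8 == 7)) (iota 0 8)) (iota 0 8)) [:: 0; 2; 6]) [:: 3; 7]) [:: 1; 5].
  by vm_compute.
move/allP: H => /(_ _ p8)/allP/(_ _ b8)/allP/(_ _ N8)/allP/(_ _ a8)/allP/(_ _ D8).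
by rewrite e1 e2 !eqxx => /eqP.
Qed.

(** As [c] is odd, [k] carries the full power of 2 in [N]; an even power has symbol 1 on both
    sides. *)
Lemma cofactor (k c : nat) : N = c * k -> odd c -> 0 < k -> coprime p k ->
  jacobi_neg k p = jacobi_neg k b.
Proof.
move=> Nck oc k0 cpk.
have [e [m [om km]]] : exists e m, odd m /\ k = 2 ^ e * m.
  exists (logn 2 k), (k`_2^'); split; last by rewrite -p_part partnC.
  by have := part_pnat 2^' k; rewrite p'natE // dvdn2 negbK.
have dkN : k %| N by rewrite Nck dvdn_mull.
have dmN : m %| N by rewrite (dvdn_trans _ dkN) // km dvdn_mull.
have cpm : coprime p m by apply: coprime_dvdr cpk; rewrite km dvdn_mull.
have cbm : coprime b m := coprime_dvdr dmN coprime_b_N.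
rewrite km !jacobi_neg_pow2M 1?coprime_sym // (odd_cofactor om dmN cpm).
case oe: (odd e) => //=; congr addb.
have : N %% 8 \in [:: 0; 2; 6].
  rewrite Nck km; case: e oe {km} => [|[|[|e]]] // _.
    have : odd (c * m) by rewrite oddM oc.
    rewrite !inE expn1 mulnCA; move: (c * m) => x; lia.
  suff -> : c * (2 ^ e.+3 * m) = (c * 2 ^ e * m) * 8 by rewrite modnMl.
  by rewrite !expnS; lia.
(* Only the pairs (1, 7) and (5, 3) remain for [p] and [b] modulo 8, and the symbols of 2 agree on
   each. *)
move/pb_mod8; rewrite -modnMm !jacobi_neg2 //.
have : p %% 8 \in [:: 1; 5] by rewrite !inE; lia.
have : b %% 8 \in [:: 3; 7] by rewrite !inE; lia.
by rewrite !inE => /orP[] /eqP -> /orP[] /eqP ->.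
Qed.

(** * The symbols of [N] and [N.+1] modulo [p] *)

Hypotheses (p_prime : prime p).

Let N_gt0 : 0 < N.
Proof. by case: N abN => // /eqP; rewrite muln_eq1; lia. Qed.

Let jacobi_N_b : jacobi_neg N b.
Proof.
rewrite (@jacobi_neg_mod _ b.-1); last first.
  apply/eqP; rewrite -(eqn_modDr 1) !addn1 prednK; last by lia.
  by rewrite -abN modnMl modnn.
by rewrite jacobi_neg_pred //; lia.
Qed.

Lemma p_ndvd_N : ~~ (p %| N).
Proof.
apply/negP => /dvdnP[k Nkp].
have k0 : 0 < k by case: k Nkp N_gt0 => // ->.
have p0 : 0 < p by lia.
have pD : p %| D.
  have : p %| D * D.
    rewrite -(dvdn_addr _ (dvdn_mulr a (dvdnn p))) -eqD Nkp mulnA.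
    exact: dvdn_mull.
  by rewrite Euclid_dvdM // orbb.
have /dvdnP[d Dd] := pD.
have cbN := coprime_b_N.
have cbp : coprime b p by apply: coprime_dvdr cbN; rewrite Nkp dvdn_mull.
have cbk : coprime b k by apply: coprime_dvdr cbN; rewrite Nkp dvdn_mulr.
(* Divide the equation by [p]; modulo [p], the factor [N.+1] is 1. *)
have ka : k = a %[mod p].
  have : N.+1 * k = a + p * (d * d).
    apply/eqP; rewrite -(eqn_pmul2l p0); apply/eqP; move: eqD.
    by rewrite Dd Nkp; lia.
  move=> e; rewrite -(modnMDl (k * k) k p) -[RHS](modnMDl (d * d)).
  by congr modn; move: e; rewrite Nkp; lia.
have ab1 : a * b = 1 %[mod p] by rewrite abN Nkp -addn1 modnMDl.
have cap : coprime a p.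
  have : coprime (a * b) p by rewrite -coprime_modl ab1 coprime_modl coprime1n.
  by rewrite coprimeMl => /andP[].
have ckp : coprime k p by rewrite -coprime_modl ka coprime_modl.
have J1 : jacobi_neg k p = jacobi_neg k b.
  by apply: (@cofactor k p) => //; rewrite 1?mulnC // coprime_sym.
have J2 : jacobi_neg a p (+) jacobi_neg b p = false.
  rewrite -jacobi_negM // (jacobi_neg_mod ab1) -(mul1n 1) jacobi_neg_sqr //.
  exact: coprime1n.
have := jacobi_N_b; rewrite Nkp jacobi_negM // 1?coprime_sym //.
have := jacobi_reciprocity op ob; rewrite coprime_sym cbp => /(_ isT).
move: J2; rewrite op2 -(jacobi_neg_mod ka) J1.
by case: (jacobi_neg k b); case: (jacobi_neg b p); case: (jacobi_neg p b).
Qed.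

Lemma jacobi_N_p : jacobi_neg N p.
Proof.
rewrite (@cofactor N 1) ?mul1n ?prime_coprime ?p_ndvd_N //; exact: jacobi_N_b.
Qed.

Lemma p_ndvd_NS : ~~ (p %| N.+1).
Proof.
apply/negP => d; have := jacobi_N_p.
rewrite (@jacobi_neg_mod _ p.-1) ?jacobi_neg_pred //; first by lia.
apply/eqP; rewrite -(eqn_modDr 1) !addn1 prednK ?modnn //; lia.
Qed.

Lemma jacobi_NS_p : jacobi_neg N.+1 p.
Proof.
have c1 : coprime N.+1 p by rewrite coprime_sym prime_coprime // p_ndvd_NS.
have c0 : coprime N p by rewrite coprime_sym prime_coprime // p_ndvd_N.
have DN : N.+1 * N = D * D %[mod p] by rewrite eqD mulnC modnMDl.
have cD : coprime D p.
  have : coprime (N.+1 * N) p by rewrite coprimeMl c1.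
  by rewrite -coprime_modl DN coprime_modl coprimeMl => /andP[].
have := jacobi_neg_mod DN; rewrite jacobi_neg_sqr // jacobi_negM // jacobi_N_p.
by case: (jacobi_neg _ _).
Qed.

End Equation.
End Jacobi.

(** * Passage to the Legendre symbol *)

Lemma legendreN1 (p n : nat) : odd p -> prime p -> ~~ (p %| n)%N ->
  jacobi_neg n p -> legendre p n%:Z = -1.
Proof.
move=> op pp pn J; rewrite /legendre dvdzE /= (negbTE pn).
(* A square root [x] of [n] modulo [p] would give [n] the symbol of [x * x], which is 1. *)
case: ifP => // /existsP[x /eqP xn].
have {}xn : (n = x * x %[mod p])%N.
  by move/eqP: xn; rewrite expr2 -PoszM !modz_nat eqz_nat => /eqP ->.
have cx : coprime x p.
  have : coprime n p by rewrite coprime_sym prime_coprime.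
  by rewrite -coprime_modl xn coprime_modl coprimeMl => /andP[].
by move: J; rewrite (jacobi_neg_mod xn) jacobi_neg_sqr.
Qed.

Theorem proposition1p9 (p : nat) (a b Delta : int)
  (p_prime : prime p) (p_mod4 : (p = 1 %[mod 4])%N)
  (a_gt0 : 0 < a) (b_gt0 : 0 < b) (Delta_gt0 : 0 < Delta)
  (abDelta : a * b * (a * b - 1) - p%:Z * a = Delta ^+ 2)
  (b_mod4 : (b = 3 %[mod 4])%Z) :
  legendre p (a * b) = -1 /\ legendre p (a * b - 1) = -1.
Proof.
(* Positivity leaves only natural numbers, so the equation can be restated without subtraction. *)
case: a a_gt0 abDelta => // a a_gt0; case: b b_gt0 b_mod4 => // b b_gt0 b4.
case: Delta Delta_gt0 => // D _.
have [N abN] : exists N, (a * b = N.+1)%N by exists (a * b).-1; lia.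
have -> : a%:Z * b%:Z - 1 = N%:Z by lia.
rewrite -PoszM abN => e.
have {}e : (N.+1 * N = p * a + D * D)%N by lia.
have {}b4 : (b %% 4 = 3)%N by lia.
have op : odd p by lia.
split; apply: legendreN1 => //.
- exact: (p_ndvd_NS p_mod4 b4 abN e).
- exact: (jacobi_NS_p p_mod4 b4 abN e).
- exact: (p_ndvd_N p_mod4 b4 abN e).
- exact: (jacobi_N_p p_mod4 b4 abN e).
Qed.
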